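(* If $N$ is a slant surface in ${\bf C}^2$, then its Gauss curvature $G$ and its normal curvature $G^D$ satisfy $G=G^D$ identically.
   Context: ${\bf C}^2$ is Euclidean $4$-space with its standard flat Kaehler structure $J$. A surface $N$ is slant if the angle $\theta$ between $JX$ and $T_xN$ is a constant independent of $x\in N$ and nonzero $X\in T_xN$. With respect to a local orthonormal frame $e_1,e_2,e_3,e_4$ with $e_1,e_2$ tangent and $e_3,e_4$ normal to $N$, put $h^r_{ij}=\langle h(e_i,e_j),e_r\rangle$, where $h$ is the second fundamental form. Then $$G=h^3_{11}h^3_{22}-(h^3_{12})^2+h^4_{11}h^4_{22}-(h^4_{12})^2,\qquad G^D=h^3_{11}h^4_{12}+h^3_{12}h^4_{22}-h^3_{12}h^4_{11}-h^3_{22}h^4_{12}.$$ For proper slant $N$ (i.e. $\theta\neq 0,\pi/2$) the frame is chosen with $e_2=(\sec\theta)Pe_1$, $e_3=(\csc\theta)Fe_1$, $e_4=(\csc\theta)Fe_2$, where $PX$, $FX$ are the tangential and normal components of $JX$; if $\theta=\pi/2$, take $e_3=Je_1$, $e_4=Je_2$. Such frames $(e_1,e_2,e_3,e_4)$ have the orientation opposite to the complex orientation of ${\bf C}^2$. In the remaining case $\theta=0$ any frame with this same orientation is used. The value of $G^D$ depends only on the orientation of $(e_1,e_2,e_3,e_4)$. *)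

(* Defs.v *)
From mathcomp Require Import all_boot all_order all_algebra.
From mathcomp Require Import all_classical all_reals all_analysis.

Set Implicit Arguments.
Unset Strict Implicit.
Unset Printing Implicit Defensive.

Import Order.TTheory GRing.Theory Num.Theory.
Import numFieldNormedType.Exports.

Local Open Scope classical_set_scope.
Local Open Scope ring_scope.

(** * Smooth maps between spaces of row vectors *)

(** Only meant for an open set [D]. *)
Fixpoint C_k (R : realType) (m n : nat) (k : nat) (D : set 'rV[R]_m)
    (f : 'rV[R]_m -> 'rV[R]_n) : Prop :=
  match k with
  | 0%N => forall u, D u -> {for u, continuous f}
  | k'.+1 => (forall u, D u -> differentiable f u)
             /\ (forall v, C_k k' D ('D_v f))
  end.

Definition smooth_on (R : realType) (m n : nat) (D : set 'rV[R]_m)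
    (f : 'rV[R]_m -> 'rV[R]_n) : Prop :=
  forall k, C_k k D f.

(** * Abstract smooth surfaces and their immersions in Euclidean 4-space *)

(** A smooth 2-manifold with an atlas: the chart of index [i] is the
    homeomorphism [param i] from the open set [dom i] of the plane onto the
    open set [param i @` dom i] of the surface, with inverse [coord i]. The
    values of [param i] outside [dom i], and of [coord i] outside
    [param i @` dom i], are irrelevant. *)
Record surface (R : realType) := Surface {
  carrier :> topologicalType ;
  surface_hausdorff : hausdorff_space carrier ;
  surface_countable : @second_countable carrier ;
  chart : Type ;
  dom : chart -> set 'rV[R]_2 ;
  param : chart -> 'rV[R]_2 -> carrier ;
  coord : chart -> carrier -> 'rV[R]_2 ;
  dom_open : forall i, open (dom i) ;
  image_open : forall i, open (param i @` dom i) ;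
  paramK : forall i u, dom i u -> coord i (param i u) = u ;
  param_continuous : forall i u, dom i u -> {for u, continuous (param i)} ;
  coord_continuous : forall i p, (param i @` dom i) p ->
    {for p, continuous (coord i)} ;
  charts_cover : forall p, exists i, (param i @` dom i) p ;
  transition_smooth : forall i j,
    smooth_on (dom i `&` param i @^-1` (param j @` dom j))
              (coord j \o param i) }.

(** A local representation [x \o param i] has its Jacobian as a 2 x 4 matrix
    acting on row vectors from the right: its row space is the tangent plane
    of the surface, seen in Euclidean 4-space. *)
Definition immersion (R : realType) (N : surface R) (x : N -> 'rV[R]_4) : Prop :=
  forall i : chart N, smooth_on (dom i) (x \o param i)
    /\ forall u, dom i u -> row_free ('J (x \o param i) u).

(** * Linear algebra of Euclidean 4-space and of C^2 *)

Definition dot (R : realType) (n : nat) (X Y : 'rV[R]_n) : R :=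
  \sum_(k < n) X 0 k * Y 0 k.

(** The library norm on row vectors is the maximum norm. *)
Definition enorm (R : realType) (n : nat) (X : 'rV[R]_n) : R :=
  Num.sqrt (dot X X).

(** The complex structure of C^2: the coordinates of R^4 are ordered as
    (x1, y1, x2, y2), with z1 = x1 + i y1 and z2 = x2 + i y2. With this order
    the complex orientation is the standard orientation of R^4. *)
Definition cplxJ (R : realType) (X : 'rV[R]_4) : 'rV[R]_4 :=
  \row_(k < 4) [:: - X 0 1; X 0 0; - X 0 3; X 0 2]`_k.

(** Orthogonal projections onto the row space of [A] and onto its orthogonal
    complement; the row space of [kermx A^T] is that complement. *)
Definition tan_part (R : realType) (A : 'M[R]_(2, 4)) (X : 'rV[R]_4) : 'rV[R]_4 :=
  X *m proj_mx <<A>>%MS (kermx A^T).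

Definition nor_part (R : realType) (A : 'M[R]_(2, 4)) (X : 'rV[R]_4) : 'rV[R]_4 :=
  X - tan_part A X.

Definition opP (R : realType) (A : 'M[R]_(2, 4)) (X : 'rV[R]_4) : 'rV[R]_4 :=
  tan_part A (cplxJ X).

Definition opF (R : realType) (A : 'M[R]_(2, 4)) (X : 'rV[R]_4) : 'rV[R]_4 :=
  nor_part A (cplxJ X).

(** The angle, in [0, pi/2], between a nonzero vector [V] and the row space
    of [A]. *)
Definition angle_to_plane (R : realType) (A : 'M[R]_(2, 4)) (V : 'rV[R]_4) : R :=
  acos (enorm (tan_part A V) / enorm V).

(** * Slant surfaces *)

Definition slant (R : realType) (N : surface R) (x : N -> 'rV[R]_4)
    (theta : R) : Prop :=
  forall (i : chart N) (u : 'rV[R]_2), dom i u ->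
  let A := 'J (x \o param i) u in
  forall X : 'rV[R]_4, (X <= A)%MS -> X != 0 ->
  angle_to_plane A (cplxJ X) = theta.

(** * Second fundamental form *)

(** [second_form f u X Y] is the normal part of the flat derivative in the
    direction [X] of a tangent vector field extending [Y]. Here [X] and [Y] are
    tangent vectors at [f u], with coordinates [a] and [b] in the basis given
    by the two partial derivatives of [f], and the extension of [Y] is the
    field ['D_b f], whose coordinates are constant. *)
Definition second_form (R : realType) (f : 'rV[R]_2 -> 'rV[R]_4) (u : 'rV[R]_2)
    (X Y : 'rV[R]_4) : 'rV[R]_4 :=
  let A := 'J f u in
  let a := X *m pinvmx A in
  let b := Y *m pinvmx A in
  nor_part A ('D_a ('D_b f) u).

(** * Frames and curvatures *)

Definition frame_mx (R : realType) (e1 e2 e3 e4 : 'rV[R]_4) : 'M[R]_4 :=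
  \matrix_(k < 4) [:: e1; e2; e3; e4]`_k.

Definition orthonormal_frame (R : realType) (A : 'M[R]_(2, 4))
    (e1 e2 e3 e4 : 'rV[R]_4) : Prop :=
  [/\ frame_mx e1 e2 e3 e4 *m (frame_mx e1 e2 e3 e4)^T = 1%:M,
      (e1 <= A)%MS, (e2 <= A)%MS,
      (e3 <= kermx A^T)%MS & (e4 <= kermx A^T)%MS].

Definition adapted_frame (R : realType) (A : 'M[R]_(2, 4)) (theta : R)
    (e1 e2 e3 e4 : 'rV[R]_4) : Prop :=
  [/\ orthonormal_frame A e1 e2 e3 e4,
      (* orientation opposite to the complex one *)
      theta = 0 -> \det (frame_mx e1 e2 e3 e4) < 0,
      theta = pi / 2 -> e3 = cplxJ e1 /\ e4 = cplxJ e2 &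
      theta <> 0 -> theta <> pi / 2 ->
        [/\ e2 = (cos theta)^-1 *: opP A e1,
            e3 = (sin theta)^-1 *: opF A e1 &
            e4 = (sin theta)^-1 *: opF A e2]].

Definition gauss_curvature (R : realType) (h : 'rV[R]_4 -> 'rV[R]_4 -> 'rV[R]_4)
    (e1 e2 e3 e4 : 'rV[R]_4) : R :=
  let h3 X Y := dot (h X Y) e3 in
  let h4 X Y := dot (h X Y) e4 in
  h3 e1 e1 * h3 e2 e2 - h3 e1 e2 ^+ 2 + h4 e1 e1 * h4 e2 e2 - h4 e1 e2 ^+ 2.

Definition normal_curvature (R : realType) (h : 'rV[R]_4 -> 'rV[R]_4 -> 'rV[R]_4)
    (e1 e2 e3 e4 : 'rV[R]_4) : R :=
  let h3 X Y := dot (h X Y) e3 in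
  let h4 X Y := dot (h X Y) e4 in
  h3 e1 e1 * h4 e1 e2 + h3 e1 e2 * h4 e2 e2
  - h3 e1 e2 * h4 e1 e1 - h3 e2 e2 * h4 e1 e2.

(* Main.v *)
Require Import Defs.
From mathcomp Require Import all_boot all_order all_algebra.
From mathcomp Require Import all_classical all_reals all_analysis.
From mathcomp Require Import ring lra.

Import Order.TTheory GRing.Theory Num.Theory.
Import numFieldNormedType.Exports.

Local Open Scope classical_set_scope.
Local Open Scope ring_scope.

(** Let [F1 = 'D_a f] and [F2 = 'D_b f] be the tangent fields with constant
    coordinates that take the values [e1] and [e2] at the given point, and put
    [omega = <J F1, F2>]. Slantness says that
    [omega ^ 2 = cos theta ^ 2 * (|F1|^2 |F2|^2 - <F1, F2>^2)] around the point.
    Differentiating this in a direction [d], the tangential terms cancel and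
    there remains [<'D_d F2, e3> = <'D_d F1, e4>], that is,
    [h^3(e2, d) = h^4(e1, d)]. For [theta = 0] that identity is void, and one
    differentiates instead the fact that [J F1] stays tangent; for
    [theta = pi / 2] one differentiates [omega = 0]. Since mixed derivatives
    commute, [h^3_12 = h^4_11] and [h^3_22 = h^4_12], which makes [G] and [G^D]
    the same polynomial. *)

(** * Directional derivatives and the symmetry of mixed second derivatives *)

(** Both difference quotients are the same function of the increment. This reduction to one real
    variable gives access to the mean value theorem. *)
Lemma is_derive_line (R : realType) (V : normedModType R) (f : V -> R)
    (u a : V) (s l : R) :
  is_derive (u + s *: a) a f l -> is_derive s 1 (fun t => f (u + t *: a)) l.
Proof.
have E : (fun h : R => h^-1 *: (((fun t => f (u + t *: a)) \o shift s) (h *: 1)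
           - f (u + s *: a))) =
         (fun h : R => h^-1 *: ((f \o shift (u + s *: a)) (h *: a) - f (u + s *: a))).
  apply/funext => h /=.
  by rewrite /= scalerDl addrCA /GRing.scale /= mulr1.
by move=> [d <-]; split; rewrite /derivable /derive E.
Qed.

Lemma is_derive_unique (R : realType) (V W : normedModType R) (f g : V -> W)
    (u d : V) (df dg : W) :
  (\forall w \near u, f w = g w) -> is_derive u d f df -> is_derive u d g dg ->
  df = dg.
Proof.
by move=> fg [_ <-] [_ <-]; exact: near_eq_derive.
Qed.

(** The mean value theorem is used twice: along [a] for the increment of [f] across [h *: b], then
    along [b] for [p]. *)
Lemma double_increment (R : realType) (V : normedModType R) (f p pq : V -> R)
    (D : set V) (u a b : V) (h : R) :
  0 < h ->
  (forall s t, 0 <= s <= h -> 0 <= t <= h -> D (u + s *: a + t *: b)) ->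
  (forall w, D w -> is_derive w a f (p w)) ->
  (forall w, D w -> is_derive w b p (pq w)) ->
  exists s t, [/\ 0 <= s <= h, 0 <= t <= h &
    f (u + h *: a + h *: b) - f (u + h *: a) - (f (u + h *: b) - f u)
      = h * (h * pq (u + s *: a + t *: b))].
Proof.
move=> h0 hD df dp.
have h0h : 0 <= h <= h by rewrite ltW/=.
have z0h : 0 <= (0 : R) <= h by rewrite lexx ltW.
pose g s := f (u + h *: b + s *: a) - f (u + s *: a).
have dg s : 0 <= s <= h ->
    is_derive s 1 g (p (u + h *: b + s *: a) - p (u + s *: a)).
  move=> sh; apply: is_deriveB; apply: is_derive_line; apply: df.
    by rewrite addrAC; exact: hD.
  by have := hD s 0 sh z0h; rewrite scale0r addr0.
have [s /andP[s0 sh]] : exists2 s, s \in `]0, h[%R &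
    g h - g 0 = (p (u + h *: b + s *: a) - p (u + s *: a)) * (h - 0).
  apply: MVT => // [s|].
    by rewrite in_itv/= => /andP[? ?]; apply: dg; rewrite !ltW.
  by apply: derivable_within_continuous => s; rewrite in_itv/= => /dg[].
rewrite /g !scale0r !addr0 subr0 => Eg.
rewrite !bnd_simp in s0 sh.
have {s0 sh}sh : 0 <= s <= h by rewrite !ltW.
pose k t := p (u + s *: a + t *: b).
have dk t : 0 <= t <= h -> is_derive t 1 k (pq (u + s *: a + t *: b)).
  by move=> th; apply: is_derive_line; apply: dp; apply: hD.
have [t /andP[t0 th]] : exists2 t, t \in `]0, h[%R &
    k h - k 0 = pq (u + s *: a + t *: b) * (h - 0).
  apply: MVT => // [t|].
    by rewrite in_itv/= => /andP[? ?]; apply: dk; rewrite !ltW.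
  by apply: derivable_within_continuous => t; rewrite in_itv/= => /dk[].
rewrite /k scale0r addr0 subr0 => Ek.
rewrite !bnd_simp in t0 th.
have {t0 th}th : 0 <= t <= h by rewrite !ltW.
exists s, t; split => //.
move: Eg; rewrite [u + h *: b + s *: a]addrAC Ek.
rewrite [u + h *: a + h *: b]addrAC => Eg.
rewrite mulrC in Eg; lra.
Qed.

(** Schwarz's theorem. The second difference of [f] over a parallelogram is symmetric in [a] and
    [b], so [pq] at one of its points equals [qp] at another. Small parallelograms bring both points
    close to [u], and continuity concludes. *)
Lemma derive_exchange (R : realType) (V : normedModType R)
    (f p q pq qp : V -> R) (u a b : V) (D : set V) :
  open D -> D u ->
  (forall w, D w -> is_derive w a f (p w)) ->
  (forall w, D w -> is_derive w b f (q w)) ->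
  (forall w, D w -> is_derive w b p (pq w)) ->
  (forall w, D w -> is_derive w a q (qp w)) ->
  {for u, continuous pq} -> {for u, continuous qp} -> pq u = qp u.
Proof.
move=> oD Du dfp dfq dp dq cpq cqp.
apply/eqP; rewrite -subr_eq0 -normr_le0; apply/ler_addgt0Pl => e e0.
have e20 : 0 < e / 2 by rewrite divr_gt0.
have : \forall w \near u,
    [/\ D w, `|pq u - pq w| < e / 2 & `|qp u - qp w| < e / 2].
  have N1 : \forall w \near u, `|pq u - pq w| < e / 2.
    by move/cvgrPdist_lt : cpq; apply.
  have N2 : \forall w \near u, `|qp u - qp w| < e / 2.
    by move/cvgrPdist_lt : cqp; apply.
  have N3 : \forall w \near u, D w by exact: open_nbhs_nbhs.
  by near=> w; split; near: w.
move=> /nbhs_ballP[r /= r0 ball_r].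
(* With sides scaled by [h = r / M] the parallelogram fits in the ball of radius [r]. The summand 1
   makes [M] positive and the final bound strict. *)
pose M := `|a| + `|b| + 1.
have M0 : 0 < M by rewrite /M ltr_wpDl// addr_ge0.
pose h := r / M.
have h0 : 0 < h by rewrite divr_gt0.
have inball s t : 0 <= s <= h -> 0 <= t <= h -> ball u r (u + s *: a + t *: b).
  move=> /andP[s0 sh] /andP[t0 th]; rewrite -ball_normE /=.
  rewrite -addrA opprD addNKr normrN (le_lt_trans (ler_normD _ _))//.
  rewrite !normrZ !ger0_norm//.
  apply: (@le_lt_trans _ _ (h * (`|a| + `|b|))).
    by rewrite mulrDr lerD// ler_wpM2r.
  by rewrite -[ltRHS](@divfK _ M) ?gt_eqF// -/h ltr_pM2l// ltrDl.
have inD s t : 0 <= s <= h -> 0 <= t <= h -> D (u + s *: a + t *: b).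
  by move=> sh th; have [] := ball_r _ (inball _ _ sh th).
have inD' s t : 0 <= s <= h -> 0 <= t <= h -> D (u + s *: b + t *: a).
  by move=> sh th; rewrite addrAC; exact: inD.
have [s1 [t1 [s1h t1h E1]]] := double_increment _ _ _ _ _ _ _ _ _ _ h0 inD dfp dp.
have [s2 [t2 [s2h t2h E2]]] := double_increment _ _ _ _ _ _ _ _ _ _ h0 inD' dfq dq.
have [_ L1 _] := ball_r _ (inball _ _ s1h t1h).
have [_ _] := ball_r _ (inball _ _ t2h s2h); rewrite addrAC => L2.
have E : pq (u + s1 *: a + t1 *: b) = qp (u + s2 *: b + t2 *: a).
  apply: (mulfI (lt0r_neq0 h0)); apply: (mulfI (lt0r_neq0 h0)).
  by rewrite -E1 -E2 [u + h *: b + h *: a]addrAC; ring.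
rewrite addr0 [e]splitr (le_trans _ (lerD (ltW L1) (ltW L2)))//.
rewrite E [X in _ <= _ + X]distrC (le_trans _ (ler_normD _ _))//.
by rewrite addrA subrK.
Unshelve. all: by end_near.
Qed.

(** * Derivatives of matrix-valued maps, of inner products and of [J] *)

Lemma is_derive_coord (R : realType) (V : normedModType R) (m n : nat)
    (F : V -> 'M[R]_(m, n)) (u d : V) (dF : 'M[R]_(m, n)) i j :
  is_derive u d F dF -> is_derive u d (fun w => F w i j) (dF i j).
Proof.
move=> [dvF <-]; split; first exact: (derivable_mxP F u d).1.
by rewrite derive_mx// mxE.
Qed.

Lemma is_derive_mx (R : realType) (V : normedModType R) (m n : nat)
    (F : V -> 'M[R]_(m, n)) (u d : V) (dF : 'M[R]_(m, n)) :
  (forall i j, is_derive u d (fun w => F w i j) (dF i j)) -> is_derive u d F dF.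
Proof.
move=> dvF; have dv : derivable F u d.
  by apply: (derivable_mxP F u d).2 => i j; have [] := dvF i j.
split => //; rewrite derive_mx//; apply/matrixP => i j; rewrite mxE.
by have [] := dvF i j.
Qed.

Lemma is_derive_dot (R : realType) (V : normedModType R) (n : nat)
    (F G : V -> 'rV[R]_n) (u d : V) (dF dG : 'rV[R]_n) :
  is_derive u d F dF -> is_derive u d G dG ->
  is_derive u d (fun w => dot (F w) (G w)) (dot dF (G u) + dot (F u) dG).
Proof.
move=> dvF dvG.
have -> : (fun w => dot (F w) (G w)) = \sum_(k < n) (fun w => F w 0 k * G w 0 k).
  by apply/funext => w; rewrite fct_sumE.
apply: is_derive_eq.
  apply: is_derive_sum => k.
  by apply: is_deriveM; apply: is_derive_coord; eassumption.
rewrite /dot -big_split/=; apply: eq_bigr => k _.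
by rewrite /GRing.scale/=; ring.
Qed.

Lemma is_derive_cplxJ (R : realType) (V : normedModType R)
    (F : V -> 'rV[R]_4) (u d : V) (dF : 'rV[R]_4) :
  is_derive u d F dF -> is_derive u d (fun w => cplxJ (F w)) (cplxJ dF).
Proof.
move=> dvF; apply: is_derive_mx => i [k k4]; rewrite !mxE/=.
under eq_fun do rewrite mxE/=.
case: k k4 => [|[|[|[|//]]]] /= _; try exact: is_derive_coord.
all: by apply: is_deriveN; exact: is_derive_coord.
Qed.

(** * Determinants of order 2 and 3 *)

Lemma det_mx2 (R : comNzRingType) (M : 'M[R]_2) :
  \det M = M 0 0 * M 1 1 - M 0 1 * M 1 0.
Proof.
rewrite (expand_det_row M 0) !big_ord_recl big_ord0 /cofactor !det_mx11 !mxE addr0.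
rewrite expr0 expr1 mul1r mulN1r mulrN.
by congr (M _ _ * M _ _ - M _ _ * M _ _); apply/val_inj.
Qed.

Lemma det_mx3 (R : comNzRingType) (M : 'M[R]_3) : \det M =
  M 0 0 * (M 1 1 * M 2 2 - M 1 2 * M 2 1) - M 0 1 * (M 1 0 * M 2 2 - M 1 2 * M 2 0)
  + M 0 2 * (M 1 0 * M 2 1 - M 1 1 * M 2 0).
Proof.
rewrite (expand_det_row M 0) !big_ord_recl big_ord0 /cofactor !det_mx2 !mxE.
rewrite /= addr0 expr0 expr1 sqrrN expr1n !mul1r mulN1r mulrN addrA.
by congr (M _ _ * (M _ _ * M _ _ - M _ _ * M _ _)
  - M _ _ * (M _ _ * M _ _ - M _ _ * M _ _)
  + M _ _ * (M _ _ * M _ _ - M _ _ * M _ _)); apply/val_inj.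
Qed.

(** * The Euclidean inner product *)

Section DotProduct.
Variables (R : realType) (n : nat).
Implicit Types X Y Z : 'rV[R]_n.

Lemma dotE X Y : dot X Y = (X *m Y^T) 0 0.
Proof. by rewrite mxE; apply: eq_bigr => k _; rewrite mxE. Qed.

Lemma dotC X Y : dot X Y = dot Y X.
Proof. by apply: eq_bigr => k _; rewrite mulrC. Qed.

Lemma dotDl X Y Z : dot (X + Y) Z = dot X Z + dot Y Z.
Proof. by rewrite !dotE mulmxDl mxE. Qed.

Lemma dotZl a X Y : dot (a *: X) Y = a * dot X Y.
Proof. by rewrite !dotE -scalemxAl mxE. Qed.

Lemma dotDr X Y Z : dot X (Y + Z) = dot X Y + dot X Z.
Proof. by rewrite dotC dotDl !(dotC X). Qed.

Lemma dotZr a X Y : dot X (a *: Y) = a * dot X Y.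
Proof. by rewrite dotC dotZl dotC. Qed.

Lemma dot0l X : dot 0 X = 0.
Proof. by rewrite dotE mul0mx mxE. Qed.

Lemma dot_ge0 X : 0 <= dot X X.
Proof. by apply: sumr_ge0 => k _; exact: sqr_ge0. Qed.

Lemma dot_eq0 X : (dot X X == 0) = (X == 0).
Proof.
apply/eqP/eqP => [X0|->]; last exact: dot0l.
apply/rowP => k; rewrite mxE; apply/eqP; rewrite -sqrf_eq0; apply/eqP.
exact: (psumr_eq0P (fun k _ => sqr_ge0 (X 0 k)) X0).
Qed.

(* In the plane spanned by [X] and [Y], Cramer's rule expresses [T] through
   its products with [X] and [Y]; if [X] and [Y] are dependent, both sides
   vanish. *)
Lemma gram_plane (A : 'M[R]_(2, n)) T X Y Z :
  (T <= A)%MS -> (X <= A)%MS -> (Y <= A)%MS ->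
  (dot X X * dot Y Y - dot X Y ^+ 2) * dot T Z =
  (dot T X * dot Y Y - dot T Y * dot X Y) * dot X Z
  + (dot T Y * dot X X - dot T X * dot X Y) * dot Y Z.
Proof.
move=> /submxP[t ->] /submxP[a ->] /submxP[b ->].
have E (v : 'rV[R]_2) : v *m A = v 0 0 *: row 0 A + v 0 1 *: row 1 A.
  rewrite mulmx_sum_row !big_ord_recl big_ord0 addr0.
  by congr (_ *: _ + v 0 _ *: row _ A); apply/val_inj.
rewrite !E !(dotDl, dotDr, dotZl, dotZr) (dotC (row 1 A) (row 0 A)).
ring.
Qed.

End DotProduct.

(** * The complex structure of the ambient space *)

Section ComplexStructure.
Variable R : realType.
Implicit Types X Y : 'rV[R]_4.

Lemma dot4E X Y :
  dot X Y = X 0 0 * Y 0 0 + X 0 1 * Y 0 1 + X 0 2 * Y 0 2 + X 0 3 * Y 0 3.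
Proof.
rewrite /dot !big_ord_recl big_ord0 addr0 !addrA.
by congr (_ + X 0 _ * Y 0 _ + X 0 _ * Y 0 _ + X 0 _ * Y 0 _); apply/val_inj.
Qed.

Lemma dot_cplxJl X Y : dot (cplxJ X) Y = - dot X (cplxJ Y).
Proof. rewrite !dot4E !mxE /=; ring. Qed.

Lemma dot_cplxJ X Y : dot (cplxJ X) (cplxJ Y) = dot X Y.
Proof. rewrite !dot4E !mxE /=; ring. Qed.

Lemma dot_cplxJxx X : dot (cplxJ X) X = 0.
Proof. rewrite !dot4E !mxE /=; ring. Qed.

(* The determinant is the squared modulus of the complex determinant of
   [X] and [Y]. *)
Lemma det_complex_frame X Y : 0 <= \det (frame_mx X (cplxJ X) Y (cplxJ Y)).
Proof.
have rowE (Z : 'rV[R]_4) :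
    Z = \row_(k < 4) [:: Z 0 0; Z 0 1; Z 0 2; Z 0 3]`_k.
  by apply/rowP => -[[|[|[|[|//]]]] k4]; rewrite mxE /=;
    congr (Z 0 _); apply/val_inj.
set x0 := X 0 0; set x1 := X 0 1; set x2 := X 0 2.
set x3 := X 0 3; set y0 := Y 0 0; set y1 := Y 0 1; set y2 := Y 0 2.
set y3 := Y 0 3.
have -> : \det (frame_mx X (cplxJ X) Y (cplxJ Y)) =
   (x0 * y2 - x1 * y3 - x2 * y0 + x3 * y1) ^+ 2
  + (x0 * y3 + x1 * y2 - x2 * y1 - x3 * y0) ^+ 2.
  rewrite (rowE X) (rowE Y) -/x0 -/x1 -/x2 -/x3 -/y0 -/y1 -/y2 -/y3.
  rewrite (expand_det_row _ 0) !big_ord_recl big_ord0 /cofactor !det_mx3.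
  rewrite !mxE /= /bump /= !add0n !expr0 !expr1.
  ring.
by rewrite addr_ge0 ?sqr_ge0.
Qed.

End ComplexStructure.

(** * Tangential and normal parts, and the slant angle *)

Section TangentPart.
Variables (R : realType) (A : 'M[R]_(2, 4)).
Implicit Types X Y V : 'rV[R]_4.

(** A vector in both spaces is orthogonal to itself. *)
Lemma capmx_kermx_tr : (<<A>> :&: kermx A^T = 0)%MS.
Proof.
apply/eqP; rewrite -submx0; apply/rV_subP => v.
rewrite sub_capmx genmxE => /andP[/submxP[t vt] /sub_kermxP vA].
rewrite submx0 -dot_eq0 dotE; rewrite [in v^T]vt trmx_mul mulmxA vA mul0mx.
by rewrite mxE.
Qed.

(** The sum is direct, and by rank-nullity its dimension is 4. *)
Lemma sub_addsmx_kermx_tr X : (X <= <<A>> + kermx A^T)%MS.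
Proof.
apply: submx_full; rewrite /row_full mxrank_disjoint_sum ?capmx_kermx_tr//.
by rewrite mxrank_gen mxrank_ker mxrank_tr subnKC// rank_leq_col.
Qed.

Lemma tan_part_sub X : (tan_part A X <= A)%MS.
Proof. by rewrite (submx_trans (proj_mx_sub _ _ _))// genmxE. Qed.

Lemma nor_part_sub X : (nor_part A X <= kermx A^T)%MS.
Proof. exact/proj_mx_compl_sub/sub_addsmx_kermx_tr. Qed.

Lemma dot_tangent_normal X Y : (X <= A)%MS -> (Y <= kermx A^T)%MS -> dot X Y = 0.
Proof.
move=> /submxP[t ->] /sub_kermxP YA.
by rewrite dotC dotE trmx_mul mulmxA YA mul0mx mxE.
Qed.

Lemma tan_part_normal X : X = tan_part A X + nor_part A X.
Proof. by rewrite /nor_part addrC subrK. Qed.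

Lemma dot_tan_part X Y : (Y <= A)%MS -> dot (tan_part A X) Y = dot X Y.
Proof.
move=> YA; rewrite [in RHS](tan_part_normal X) dotDl (dotC _ _ (nor_part A X)).
by rewrite (dot_tangent_normal _ _ YA (nor_part_sub X)) addr0.
Qed.

Lemma dot_nor_part X Y : (Y <= kermx A^T)%MS -> dot (nor_part A X) Y = dot X Y.
Proof.
move=> YA; rewrite [in RHS](tan_part_normal X) dotDl.
by rewrite (dot_tangent_normal _ _ (tan_part_sub X) YA) add0r.
Qed.

Lemma dot_decomp X :
  dot X X = dot (tan_part A X) (tan_part A X) + dot (nor_part A X) (nor_part A X).
Proof.
have := dot_tangent_normal _ _ (tan_part_sub X) (nor_part_sub X).
move: (tan_part_normal X) => /(congr1 (fun Y => dot Y Y)) /= ->.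
move: (tan_part A X) (nor_part A X) => T Z TZ.
by rewrite !dotDl !dotDr (dotC _ _ Z T) TZ addr0 add0r.
Qed.

(** The ratio [r] is exposed with its bounds because they let [acosK] recover it as the cosine of
    the angle. *)
Lemma angle_to_planeP V : V != 0 ->
  exists2 r : R, 0 <= r <= 1 & angle_to_plane A V = acos r /\
    dot (tan_part A V) (tan_part A V) = r ^+ 2 * dot V V.
Proof.
move=> V0; have VV0 : 0 < dot V V by rewrite lt_neqAle eq_sym dot_eq0 V0 dot_ge0.
have eV0 : 0 < enorm V by rewrite sqrtr_gt0.
exists (enorm (tan_part A V) / enorm V).
  rewrite divr_ge0 ?sqrtr_ge0//= ler_pdivrMr// mul1r ler_wsqrtr//.
  by rewrite [leRHS]dot_decomp lerDl dot_ge0.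
split=> //; rewrite expr_div_n !sqr_sqrtr ?dot_ge0// divfK//.
by rewrite gt_eqF.
Qed.

(** Clearing the quotient and the square root gives an identity that also covers [X = 0], where the
    hypothesis is silent. *)
Lemma slant_tan_part theta X :
  (forall X, (X <= A)%MS -> X != 0 -> angle_to_plane A (cplxJ X) = theta) ->
  (X <= A)%MS ->
  dot (tan_part A (cplxJ X)) (tan_part A (cplxJ X)) = cos theta ^+ 2 * dot X X.
Proof.
move=> slantA XA; have [->|X0] := eqVneq X 0.
  have -> : cplxJ (0 : 'rV[R]_4) = 0.
    by apply/eqP; rewrite -dot_eq0 dot_cplxJ dot0l.
  by rewrite /tan_part mul0mx !dot0l mulr0.
have JX0 : cplxJ X != 0 by rewrite -dot_eq0 dot_cplxJ dot_eq0.
have [r /andP[r0 r1] [Er ->]] := angle_to_planeP (cplxJ X) JX0.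
rewrite -(slantA X)// Er acosK ?dot_cplxJ// in_itv/= r1 andbT.
by rewrite (le_trans _ r0)// lerN10.
Qed.

(** Let [T] be the tangential part of [J X]. It is orthogonal to [X], so Cramer's rule paired with
    [T] itself gives [|T|^2 (|X|^2 |Y|^2 - <X, Y>^2) = <T, Y>^2 |X|^2]. Here
    [|T|^2 = cos theta ^ 2 * |X|^2], and [|X|^2] cancels. *)
Lemma slant_kaehler theta X Y :
  (forall X, (X <= A)%MS -> X != 0 -> angle_to_plane A (cplxJ X) = theta) ->
  (X <= A)%MS -> (Y <= A)%MS ->
  dot (cplxJ X) Y ^+ 2 = cos theta ^+ 2 * (dot X X * dot Y Y - dot X Y ^+ 2).
Proof.
move=> slantA XA YA; have [->|X0] := eqVneq X 0.
  by rewrite dot_cplxJl !dot0l; ring.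
have XX0 : dot X X != 0 by rewrite dot_eq0.
apply: (mulIf XX0); set T := tan_part A (cplxJ X).
have := gram_plane _ _ A T X Y T (tan_part_sub _) XA YA.
rewrite (slant_tan_part theta)// (dotC _ _ X T) (dotC _ _ Y T).
rewrite !dot_tan_part// dot_cplxJxx.
lra.
Qed.

(** For angle 0 the tangential part of [J X] is as long as [J X], so by Pythagoras the normal part
    vanishes. *)
Lemma complex_tangent X :
  (forall X, (X <= A)%MS -> X != 0 -> angle_to_plane A (cplxJ X) = 0) ->
  (X <= A)%MS -> (cplxJ X <= A)%MS.
Proof.
move=> slantA XA; have := dot_decomp (cplxJ X).
rewrite (slant_tan_part 0)// cos0 expr1n mul1r dot_cplxJ => /esym/eqP.
rewrite -subr_eq0 addrAC subrr add0r dot_eq0 => /eqP nor0.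
by rewrite (tan_part_normal (cplxJ X)) nor0 addr0 tan_part_sub.
Qed.

End TangentPart.

(** * Orthonormal frames *)

Section OrthonormalFrame.
Variables (R : realType) (e1 e2 e3 e4 : 'rV[R]_4).
Hypothesis frame1 : frame_mx e1 e2 e3 e4 *m (frame_mx e1 e2 e3 e4)^T = 1%:M.

Lemma dot_frame (i j : 'I_4) :
  dot [:: e1; e2; e3; e4]`_i [:: e1; e2; e3; e4]`_j = (i == j)%:R.
Proof.
have /matrixP/(_ i j) := frame1; rewrite !mxE => <-.
by apply: eq_bigr => k _; rewrite !mxE.
Qed.

Lemma frame_expand V :
  V = dot V e1 *: e1 + dot V e2 *: e2 + dot V e3 *: e3 + dot V e4 *: e4.
Proof.
(* The transpose of the frame matrix is also its left inverse. *)
rewrite -[LHS]mulmx1 -(mulmx1C frame1) mulmxA mulmx_sum_row.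
rewrite !big_ord_recl big_ord0 addr0 !addrA !rowK /=.
have E k : (V *m (frame_mx e1 e2 e3 e4)^T) 0 k = dot V [:: e1; e2; e3; e4]`_k.
  by rewrite mxE; apply: eq_bigr => l _; rewrite !mxE.
by rewrite !E.
Qed.

End OrthonormalFrame.

(** Serves to compare the orientation of an adapted frame with that of [e1, J e1, e3, J e3] when
    [J e1] and [J e3] are multiples of [e2] and [e4]. *)
Lemma det_frame_scale (R : realType) (e1 e2 e3 e4 : 'rV[R]_4) (a b : R) :
  \det (frame_mx e1 (a *: e2) e3 (b *: e4)) = a * b * \det (frame_mx e1 e2 e3 e4).
Proof.
have -> : frame_mx e1 (a *: e2) e3 (b *: e4) =
    diag_mx (\row_(k < 4) [:: 1; a; 1; b]`_k) *m frame_mx e1 e2 e3 e4.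
  apply/matrixP => i j; rewrite mul_diag_mx !mxE.
  by case: i => [[|[|[|[|//]]]] k4] /=; rewrite ?mxE ?mul1r.
rewrite det_mulmx det_diag !big_ord_recl big_ord0 !mxE /=.
by rewrite !mul1r mulr1.
Qed.

(** * The slant condition differentiated along a direction *)

(** The product rule with [*] in place of [*:], a form that suits [ring]. *)
Lemma is_derive_mul (R : realType) (V : normedModType R) (f g : V -> R)
    (u d : V) (df dg : R) :
  is_derive u d f df -> is_derive u d g dg ->
  is_derive u d (fun w => f w * g w) (f u * dg + g u * df).
Proof. exact: is_deriveM. Qed.

Section SlantDerivative.
Variables (R : realType) (V : normedModType R).
Variables (A : V -> 'M[R]_(2, 4)) (theta : R) (F1 F2 : V -> 'rV[R]_4) (u : V).
Variables (e1 e2 e3 e4 : 'rV[R]_4).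

Hypothesis slantA : \forall w \near u, forall X,
  (X <= A w)%MS -> X != 0 -> angle_to_plane (A w) (cplxJ X) = theta.
Hypothesis F1A : \forall w \near u, (F1 w <= A w)%MS.
Hypothesis F2A : \forall w \near u, (F2 w <= A w)%MS.
Hypothesis F1u : F1 u = e1.
Hypothesis F2u : F2 u = e2.
Hypothesis adapted : adapted_frame (A u) theta e1 e2 e3 e4.

Let omega w := dot (cplxJ (F1 w)) (F2 w).
(** The squared area of the parallelogram spanned by [F1 w] and [F2 w]; it is 1 at [u]. *)
Let gram w := dot (F1 w) (F1 w) * dot (F2 w) (F2 w) - dot (F1 w) (F2 w) ^+ 2.

Lemma kaehler_eq : \forall w \near u, omega w ^+ 2 = cos theta ^+ 2 * gram w.
Proof.
near=> w; apply: (slant_kaehler _ (A w)) => //; near: w; eassumption.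
Unshelve. all: by end_near.
Qed.

Section Direction.
Variables (dF1 dF2 : 'rV[R]_4) (dir : V).
Hypothesis dvF1 : is_derive u dir F1 dF1.
Hypothesis dvF2 : is_derive u dir F2 dF2.

Lemma frame_dots :
  [/\ dot e1 e1 = 1, dot e2 e2 = 1, dot e1 e2 = 0, dot e1 e3 = 0 & dot e2 e3 = 0].
Proof.
case: adapted => [[fr _ _ _ _] _ _ _].
have dots := dot_frame _ _ _ _ _ fr.
by split; [exact: (dots 0 0)|exact: (dots 1 1)|exact: (dots 0 1)|exact: (dots 0 2)
  |exact: (dots 1 2)].
Qed.

Lemma is_derive_omega :
  is_derive u dir omega (- dot dF1 (cplxJ e2) + dot (cplxJ e1) dF2).
Proof.
rewrite -dot_cplxJl -F1u -F2u.
by apply: is_derive_dot => //; exact: is_derive_cplxJ.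
Qed.

(** Since [e1] and [e2] are orthonormal, only the two squared lengths contribute to first order. *)
Lemma is_derive_gram :
  is_derive u dir gram (2 * (dot dF1 e1 + dot dF2 e2)).
Proof.
have [d11 d22 d12 _ _] := frame_dots.
have -> : gram = (fun w => dot (F1 w) (F1 w) * dot (F2 w) (F2 w)
    - dot (F1 w) (F2 w) * dot (F1 w) (F2 w)).
  by apply/funext => w; rewrite /gram expr2.
apply: is_derive_eq.
  by apply: is_deriveB; apply: is_derive_mul; apply: is_derive_dot; eassumption.
rewrite /= F1u F2u d11 d22 d12 (dotC _ _ e1 dF1) (dotC _ _ e2 dF2); ring.
Qed.

Lemma symmetry_lagrangian : theta = pi / 2 -> dot dF2 e3 = dot dF1 e4.
Proof.
move=> thetaE; case: adapted => [_ _ /(_ thetaE)[-> ->] _].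
have omega0 : \forall w \near u, omega w = 0.
  near=> w; apply/eqP; rewrite -sqrf_eq0; apply/eqP.
  rewrite (near kaehler_eq w)// thetaE cos_pihalf; ring.
have := is_derive_unique _ _ _ _ _ _ _ _ _ omega0 is_derive_omega
  (is_derive_cst 0 u dir).
by rewrite (dotC _ _ dF2) addrC => /subr0_eq.
Unshelve. all: by end_near.
Qed.

(** In the adapted frame [J e1 = cos theta e2 + sin theta e3] and
    [J e2 = - cos theta e1 + sin theta e4]. With these, both sides of the differentiated
    [kaehler_eq] contain the same tangential terms. *)
Lemma symmetry_proper : theta <> 0 -> theta <> pi / 2 -> dot dF2 e3 = dot dF1 e4.
Proof.
move=> theta0 thetaN; case: adapted => [[fr e1A e2A e3N e4N] _ _].
move=> /(_ theta0 thetaN)[E2 E3 E4].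
have [d11 d22 d12 _ _] := frame_dots.
have e1_neq0 : e1 != 0 by rewrite -dot_eq0 d11 oner_neq0.
(* So far [theta] is an arbitrary real. Being the angle of [J e1], it equals [acos r] with
   [0 <= r <= 1], so [cos theta = 0] would force [pi / 2] and [sin theta = 0] would force 0. *)
have [|r /andP[r0 r1] [thetaE _]] := angle_to_planeP _ (A u) (cplxJ e1).
  by rewrite -dot_eq0 dot_cplxJ dot_eq0.
rewrite (nbhs_singleton slantA)// in thetaE.
have cosE : cos theta = r.
  rewrite thetaE acosK// in_itv/= r1 andbT.
  by rewrite (le_trans _ r0)// lerN10.
have c0 : cos theta != 0.
  by apply/eqP => c0; apply: thetaN; rewrite thetaE -cosE c0 acos0.
have s0 : sin theta != 0.
  apply/eqP => s0; apply: theta0; rewrite thetaE.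
  have /eqP := cos2Dsin2 theta.
  rewrite s0 expr0n addr0 cosE sqrp_eq1// => /eqP ->.
  exact: acos1.
have JE1 : cplxJ e1 = cos theta *: e2 + sin theta *: e3.
  rewrite E2 E3 !scalerA !mulfV// !scale1r.
  exact: tan_part_normal.
have FE2 : opF (A u) e2 = sin theta *: e4 by rewrite E4 scalerA mulfV// scale1r.
(* By skewness of [J], the coefficient on [e1] is [- <e2, J e1>], and the one on [e2] is zero. *)
have PE2 : opP (A u) e2 = - cos theta *: e1.
  rewrite [LHS](frame_expand _ _ _ _ _ fr).
  rewrite (dot_tangent_normal _ _ _ _ (tan_part_sub _ _ _) e3N).
  rewrite (dot_tangent_normal _ _ _ _ (tan_part_sub _ _ _) e4N).
  rewrite /opP !dot_tan_part// dot_cplxJl JE1 dotDr !dotZr d22 dot_cplxJxx.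
  rewrite (dot_tangent_normal _ _ _ _ e2A e3N) !scale0r !addr0.
  by rewrite mulr0 mulr1 addr0.
have JE2 : cplxJ e2 = - cos theta *: e1 + sin theta *: e4.
  by rewrite (tan_part_normal _ (A u) (cplxJ e2)) -/(opP _ _) -/(opF _ _) PE2 FE2.
have omega_u : omega u = cos theta.
  rewrite /omega F1u F2u JE1 dotDl !dotZl d22 (dotC _ _ e3).
  by rewrite (dot_tangent_normal _ _ _ _ e2A e3N) mulr0 mulr1 addr0.
have dvL : is_derive u dir (fun w => omega w ^+ 2)
    (2 * cos theta * (- dot dF1 (cplxJ e2) + dot (cplxJ e1) dF2)).
  have -> : (fun w => omega w ^+ 2) = (fun w => omega w * omega w).
    by apply/funext => w; rewrite expr2.
  apply: is_derive_eq; first by apply: is_derive_mul; exact: is_derive_omega.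
  by rewrite omega_u; ring.
have dvR : is_derive u dir (fun w => cos theta ^+ 2 * gram w)
    (cos theta ^+ 2 * (2 * (dot dF1 e1 + dot dF2 e2))).
  exact: is_deriveZ is_derive_gram.
have := is_derive_unique _ _ _ _ _ _ _ _ _ kaehler_eq dvL dvR.
rewrite JE1 JE2 dotDl dotDr !dotZl !dotZr (dotC _ _ e2) (dotC _ _ e3) => E.
(* What remains is the claim multiplied by [2 cos theta sin theta]. *)
apply: (mulfI s0); apply: (mulfI c0); lra.
Qed.

(** Here [J e1 = eps e2] and [J e3 = tau e4] with signs [eps] and [tau], and the orientation forces
    [tau = - eps]. Differentiating the tangency of [J F1] gives [<J dF1, e3> = eps <dF2, e3>], whose
    left side is [- tau <dF1, e4>]. *)
Lemma symmetry_holomorphic : theta = 0 -> dot dF2 e3 = dot dF1 e4.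
Proof.
move=> theta0; case: adapted => [[fr e1A e2A e3N e4N] /(_ theta0) det_lt0 _ _].
have [d11 d22 d12 d13 d23] := frame_dots.
have d33 := dot_frame _ _ _ _ _ fr 2 2.
have slant0 := slantA; rewrite theta0 in slant0.
have slant0u := nbhs_singleton slant0.
have Je1A := complex_tangent _ _ _ slant0u e1A.
have Je2A := complex_tangent _ _ _ slant0u e2A.
pose eps := dot (cplxJ e1) e2; pose tau := dot (cplxJ e3) e4.
have Je1 : cplxJ e1 = eps *: e2.
  rewrite [LHS](frame_expand _ _ _ _ _ fr) dot_cplxJxx.
  rewrite (dot_tangent_normal _ _ _ _ Je1A e3N).
  rewrite (dot_tangent_normal _ _ _ _ Je1A e4N).
  by rewrite !scale0r !addr0 add0r.
have Je3 : cplxJ e3 = tau *: e4.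
  (* [J] preserves the tangent plane, hence also its orthogonal complement. *)
  have Je3N X : (cplxJ X <= A u)%MS -> dot (cplxJ e3) X = 0.
    move=> JXA; rewrite dot_cplxJl dotC.
    by rewrite (dot_tangent_normal _ _ _ _ JXA e3N) oppr0.
  rewrite [LHS](frame_expand _ _ _ _ _ fr) dot_cplxJxx (Je3N e1)// (Je3N e2)//.
  by rewrite !scale0r !add0r.
have eps2 : eps ^+ 2 = 1.
  by have := dot_cplxJ _ e1 e1; rewrite Je1 dotZl dotZr d22 d11 mulr1.
have tau2 : tau ^+ 2 = 1.
  have := dot_cplxJ _ e3 e3; rewrite Je3 dotZl dotZr d33.
  by rewrite (dot_frame _ _ _ _ _ fr 3 3) mulr1.
(* [e1, J e1, e3, J e3] is a complex frame, while [e1, e2, e3, e4] has the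
   opposite orientation. *)
have tauE : tau = - eps.
  have := det_complex_frame _ e1 e3; rewrite Je1 Je3 det_frame_scale.
  rewrite nmulr_lge0// => et_le0.
  have /eqP : tau ^+ 2 = eps ^+ 2 by rewrite tau2.
  rewrite eqf_sqr => /orP[/eqP te|/eqP//].
  by move: et_le0; rewrite te -expr2 eps2 ler10.
(* Cramer's rule for the tangent vector [J F1], paired with the fixed vector [e3]. All products with
   [e3] vanish at [u], so only their derivatives survive there. *)
have E : \forall w \near u, gram w * dot (cplxJ (F1 w)) e3 =
    omega w * (dot (F1 w) (F1 w) * dot (F2 w) e3
      - dot (F1 w) (F2 w) * dot (F1 w) e3).
  near=> w.
  have FA1 : (F1 w <= A w)%MS by near: w.
  have FA2 : (F2 w <= A w)%MS by near: w.
  have JFA : (cplxJ (F1 w) <= A w)%MS.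
    by apply: complex_tangent => //; near: w.
  have := gram_plane _ _ _ _ _ _ e3 JFA FA1 FA2.
  by rewrite dot_cplxJxx -/(omega w) -/(gram w) => ->; ring.
have dv3 (F : V -> 'rV[R]_4) dF : is_derive u dir F dF ->
    is_derive u dir (fun w => dot (F w) e3) (dot dF e3).
  move=> dvF; apply: is_derive_eq.
    exact: is_derive_dot dvF (is_derive_cst e3 u dir).
  by rewrite (dotC _ _ _ 0) dot0l addr0.
have dvL : is_derive u dir (fun w => gram w * dot (cplxJ (F1 w)) e3)
    (dot (cplxJ dF1) e3).
  apply: is_derive_eq.
    apply: is_derive_mul; first exact: is_derive_gram.
    exact/dv3/is_derive_cplxJ.
  rewrite /gram F1u F2u d11 d22 d12 (dot_tangent_normal _ _ _ _ Je1A)//; ring.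
have dvR : is_derive u dir (fun w => omega w *
    (dot (F1 w) (F1 w) * dot (F2 w) e3
      - dot (F1 w) (F2 w) * dot (F1 w) e3))
    (eps * dot dF2 e3).
  apply: is_derive_eq.
    apply: is_derive_mul; first exact: is_derive_omega.
    apply: is_deriveB; apply: is_derive_mul; try exact: dv3; exact: is_derive_dot.
  by rewrite /omega F1u F2u d11 d12 d13 d23 -/eps; ring.
have := is_derive_unique _ _ _ _ _ _ _ _ _ E dvL dvR.
rewrite dot_cplxJl Je3 dotZr tauE mulNr opprK => /esym.
apply: mulfI; apply/eqP => eps0; move: eps2; rewrite eps0 expr0n => /eqP.
by rewrite eq_sym oner_eq0.
Unshelve. all: by end_near.
Qed.

Lemma second_derivative_symmetry : dot dF2 e3 = dot dF1 e4.
Proof.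
have [|/eqP ?] := eqVneq theta 0; first exact: symmetry_holomorphic.
have [|/eqP ?] := eqVneq theta (pi / 2); first exact: symmetry_lagrangian.
exact: symmetry_proper.
Qed.

End Direction.
End SlantDerivative.

(** * Symmetries of the second fundamental form and equality of the curvatures *)

Lemma derive_swap (R : realType) (m n : nat) (D : set 'rV[R]_m)
    (f : 'rV[R]_m -> 'rV[R]_n) (u a b : 'rV[R]_m) :
  open D -> D u -> C_k 2 D f -> 'D_b ('D_a f) u = 'D_a ('D_b f) u.
Proof.
move=> oD Du [df C1f]; apply/rowP => j.
have dvf v w : D w -> is_derive w v f ('D_v f w).
  by move=> Dw; apply/derivableP/diff_derivable/df.
have ddvf v v' w : D w -> is_derive w v' ('D_v f) ('D_v' ('D_v f) w).
  by move=> Dw; apply/derivableP/diff_derivable; have [dDf _] := C1f v; exact: dDf.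
have cddf v v' : {for u, continuous (fun w => 'D_v' ('D_v f) w 0 j)}.
  have [_ cDDf] := C1f v.
  apply: (@continuous_comp _ _ _ ('D_v' ('D_v f)) (fun M : 'rV[R]_n => M 0 j)).
    exact: cDDf.
  exact: coord_continuous.
apply: (derive_exchange R _ (fun w => f w 0 j) (fun w => 'D_a f w 0 j)
  (fun w => 'D_b f w 0 j) (fun w => 'D_b ('D_a f) w 0 j)
  (fun w => 'D_a ('D_b f) w 0 j) u a b D) => // w Dw; apply: is_derive_coord; auto.
Qed.

Lemma gauss_eq_normal_curvature (R : realType)
    (h : 'rV[R]_4 -> 'rV[R]_4 -> 'rV[R]_4)
    (e1 e2 e3 e4 : 'rV[R]_4) :
  dot (h e1 e2) e3 = dot (h e1 e1) e4 -> dot (h e2 e2) e3 = dot (h e1 e2) e4 ->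
  gauss_curvature h e1 e2 e3 e4 = normal_curvature h e1 e2 e3 e4.
Proof. by rewrite /gauss_curvature /normal_curvature => -> ->; ring. Qed.

Theorem theorem3p7 (R : realType) (N : surface R) (x : N -> 'rV[R]_4)
    (theta : R) (x_immersion : immersion x) (x_slant : slant x theta)
    (i : chart N) (u : 'rV[R]_2) (u_dom : dom i u)
    (e1 e2 e3 e4 : 'rV[R]_4)
    (e_adapted : adapted_frame ('J (x \o param i) u) theta e1 e2 e3 e4) :
  let h := second_form (x \o param i) u in
  gauss_curvature h e1 e2 e3 e4 = normal_curvature h e1 e2 e3 e4.
Proof.
move=> h; pose f := x \o param i; rewrite -/f in e_adapted.
have [/(_ 2%N) C2f _] := x_immersion i.
have nbhsD : \forall w \near u, dom i w.
  by apply: open_nbhs_nbhs; split => //; exact: dom_open.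
have [df C1f] := C2f.
have dfA v w : dom i w -> ('D_v f w <= 'J f w)%MS.
  by move=> Dw; rewrite deriveEjacobian ?submxMl//; exact: df.
have slantA : \forall w \near u, forall X, (X <= 'J f w)%MS -> X != 0 ->
    angle_to_plane ('J f w) (cplxJ X) = theta.
  by apply: filterS nbhsD => w Dw; exact: (x_slant i w Dw).
have [[_ e1A e2A e3N e4N] _ _ _] := e_adapted.
(* The coordinates used by [second_form]: ['D_a f] and ['D_b f] are the fields extending [e1] and
   [e2] there. *)
set a := e1 *m pinvmx ('J f u); set b := e2 *m pinvmx ('J f u).
have F1u : 'D_a f u = e1 by rewrite deriveEjacobian ?mulmxKpV//; exact: df.
have F2u : 'D_b f u = e2 by rewrite deriveEjacobian ?mulmxKpV//; exact: df.
(* Direction [a] yields [h^3_12 = h^4_11], direction [b] yields [h^3_22 = h^4_12]. *)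
have symm v : dot ('D_v ('D_b f) u) e3 = dot ('D_v ('D_a f) u) e4.
  apply: (second_derivative_symmetry _ _ _ _ ('D_a f) ('D_b f) _ _ _ _ _ slantA
    _ _ F1u F2u e_adapted _ _ v).
  - by apply: filterS nbhsD => w; exact: dfA.
  - by apply: filterS nbhsD => w; exact: dfA.
  - by apply/derivableP/diff_derivable; have [dDf _] := C1f a; exact: dDf.
  - by apply/derivableP/diff_derivable; have [dDf _] := C1f b; exact: dDf.
have swap : 'D_b ('D_a f) u = 'D_a ('D_b f) u.
  by apply: (derive_swap _ _ _ (dom i)) => //; exact: dom_open.
have hE e X Y : (e <= kermx ('J f u)^T)%MS ->
    dot (h X Y) e =
    dot ('D_(X *m pinvmx ('J f u)) ('D_(Y *m pinvmx ('J f u)) f) u) e.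
  exact: dot_nor_part.
apply: gauss_eq_normal_curvature.
  exact: etrans (hE e3 e1 e2 e3N) (etrans (symm a) (esym (hE e4 e1 e1 e4N))).
apply: etrans (hE e3 e2 e2 e3N) (etrans (symm b) _).
(* In [h e1 e2] the field ['D_b f] is differentiated along [a], while [symm b] produces the opposite
   order. *)
rewrite swap; exact: esym (hE e4 e1 e2 e4N).
Qed.
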